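(* Let $X,Y$ be normed spaces where $\dim X=1$. (i) If $\dim Y=1$, then every graph is $(X,Y)$-flattenable. (ii) If $\dim Y\geq 2$, then a graph is $(X,Y)$-flattenable if and only if it is a forest.
   Context: All normed spaces are real and have dimension greater than zero; $\dim Y\ge 2$ includes infinite-dimensional $Y$. A graph $G=(V,E)$ is finite and simple with at least one edge. The measurement map of $(G,X)$ is $f_{G,X}:X^V\to\mathbb{R}^E$, $(x_v)_{v\in V}\mapsto(\|x_v-x_w\|_X)_{vw\in E}$. The graph $G$ is $(X,Y)$-flattenable if $f_{G,X}(X^V)\supseteq f_{G,Y}(Y^V)$. A forest is a graph with no cycles. *)

(* Defs.v *)
From HB Require Import structures.
From mathcomp Require Import all_boot all_order all_algebra.
From mathcomp Require Import all_classical all_reals all_analysis.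

Set Implicit Arguments.
Unset Strict Implicit.
Unset Printing Implicit Defensive.

Import Order.TTheory GRing.Theory Num.Theory numFieldNormedType.Exports.
Local Open Scope classical_set_scope.
Local Open Scope ring_scope.

(* The library's \dim is for vectType, i.e. finite-dimensional spaces only;
   the notions below make sense on an arbitrary lmodType. *)
Section Dimension.
Variables (R : nzRingType) (V : lmodType R).

Definition lin_indep (n : nat) (v : 'I_n -> V) : Prop :=
  forall a : 'I_n -> R, \sum_(i < n) a i *: v i = 0 -> forall i, a i = 0.

Definition spanning (n : nat) (v : 'I_n -> V) : Prop :=
  forall x : V, exists a : 'I_n -> R, x = \sum_(i < n) a i *: v i.

Definition dim_eq (n : nat) : Prop :=
  exists v : 'I_n -> V, lin_indep v /\ spanning v.

(* Holds in particular, for every n, of infinite-dimensional spaces. *)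
Definition dim_ge (n : nat) : Prop := exists v : 'I_n -> V, lin_indep v.

End Dimension.

Arguments dim_eq {R} V n.
Arguments dim_ge {R} V n.

(* Edges are two-element sets of vertices, so there are neither loops nor
   parallel edges. *)
Record graph := Graph {
  vertex : finType;
  edges : {set {set vertex}};
  edges_card2 : forall A : {set vertex}, A \in edges -> #|A| = 2%N;
  edges_neq0 : edges != finset.set0
}.

Definition edge (G : graph) := {A : {set vertex G} | A \in edges G}.

Definition adj (G : graph) : rel (vertex G) :=
  fun v w => [set v; w]%SET \in edges G.

(* A cycle is a cyclic sequence of at least three distinct vertices,
   consecutive ones (and the last and the first) being adjacent. *)
Definition is_cycle (G : graph) (c : seq (vertex G)) : Prop :=
  (3 <= size c)%N /\ ucycle (@adj G) c.

Definition forest (G : graph) : Prop :=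
  ~ exists c : seq (vertex G), is_cycle c.

Lemma edge_endsP (G : graph) (A : edge G) :
  exists p : vertex G * vertex G, val A == [set p.1; p.2]%SET.
Proof.
have /eqP/cards2P[v [w [_ ->]]] := edges_card2 (valP A).
by exists (v, w).
Qed.

(* An enumeration of the two ends of an edge, in an arbitrary order. *)
Definition edge_ends (G : graph) (A : edge G) : vertex G * vertex G :=
  xchoose (edge_endsP A).

Definition measurement (R : realType) (G : graph) (X : normedModType R)
    (x : vertex G -> X) : edge G -> R :=
  fun A => `|x (edge_ends A).1 - x (edge_ends A).2|.

Arguments measurement {R} G X x.

(* The choice made by edge_ends is immaterial. *)
Lemma measurementE (R : realType) (G : graph) (X : normedModType R)
    (x : vertex G -> X) (v w : vertex G) (vw : [set v; w]%SET \in edges G) :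
  measurement G X x (exist _ [set v; w]%SET vw) = `|x v - x w|.
Proof.
rewrite /measurement /edge_ends; set A := exist _ _ _.
have := xchooseP (edge_endsP A); move: (xchoose _) => -[a b] /= /eqP E.
have Ha : a \in [set v; w]%SET by rewrite E !inE eqxx.
have Hb : b \in [set v; w]%SET by rewrite E !inE eqxx orbT.
have Hv : v \in [set a; b]%SET by rewrite -E !inE eqxx.
have Hw : w \in [set a; b]%SET by rewrite -E !inE eqxx orbT.
move: Ha Hb Hv Hw; rewrite !inE.
case/orP=> /eqP->; case/orP=> /eqP-> //; last 1 first.
- by rewrite orbb => /eqP->.
- by move=> _; rewrite orbb => /eqP->.
- by rewrite distrC.
Qed.

Definition flattenable (R : realType) (X Y : normedModType R) (G : graph) :
    Prop :=
  range (measurement G Y) `<=` range (measurement G X).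

(* Main.v *)
Require Import Defs.
From mathcomp Require Import all_boot all_order all_algebra.
From mathcomp Require Import all_classical all_reals all_analysis.
From mathcomp Require Import lra.

(** A one-dimensional normed space is an isometric copy of the real line, so
    everything about [X] reduces to distances between real numbers, and (i)
    is immediate.

    In (ii), a forest imposes no condition at all on its edge lengths
    ([acyclic_realizable]): deleting an edge separates its two ends, so after
    realizing the remaining edges, one of the two sides can be translated
    until the deleted edge has the required length.

    Conversely, let [G] contain a cycle.  A space of dimension at least two
    contains a triangle with two sides of length 1 and a third side of length
    strictly between 0 and 2 ([exists_thin_triangle]), and no three points of
    the line have these distances.  Place two consecutive vertices of the cycle
    at two corners of this triangle and all the other vertices at the third.
    All the edges of the cycle but three have length 0, so a realization on the
    line would collapse them and leave such a forbidden triangle. *)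

Set Implicit Arguments.
Unset Strict Implicit.
Unset Printing Implicit Defensive.

Import Order.TTheory GRing.Theory Num.Theory numFieldNormedType.Exports.
Local Open Scope ring_scope.

Lemma dim_eq1_unit (R : realType) (X : normedModType R) :
  dim_eq X 1 -> exists2 e : X, `|e| = 1 & forall x, exists a : R, x = a *: e.
Proof.
move=> [v [ind span]].
have v0 : v ord0 != 0.
  apply/eqP => v0.
  have /(_ _ ord0)/eqP := ind (fun=> 1); rewrite oner_eq0.
  by rewrite big_ord1 v0 scaler0 => /(_ erefl).
have nv0 : `|v ord0| != 0 by rewrite normr_eq0.
exists (`|v ord0|^-1 *: v ord0).
  by rewrite normrZ normfV normr_id mulVf.
move=> x; have [a] := span x; rewrite big_ord1 => ->.
by exists (a ord0 * `|v ord0|); rewrite scalerA mulfK.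
Qed.

Lemma dist_scale_unit (R : realType) (X : normedModType R) (e : X) (a b : R) :
  `|e| = 1 -> `|a *: e - b *: e| = `|a - b|.
Proof. by move=> e1; rewrite -scalerBl normrZ e1 mulr1. Qed.

Lemma adj_sym (G : graph) : symmetric (@adj G).
Proof. by move=> v w; rewrite /adj finset.setUC. Qed.

Lemma adj_irr (G : graph) : irreflexive (@adj G).
Proof.
move=> v; apply/negP => /edges_card2.
by rewrite finset.setUid cards1.
Qed.

Lemma adj_edge_ends (G : graph) (A : edge G) :
  adj (edge_ends A).1 (edge_ends A).2.
Proof.
by rewrite /adj -(eqP (xchooseP (edge_endsP A))) (valP A).
Qed.

(** The form in which flattenability is used: [edge_ends] is eliminated in
    favour of the adjacency relation. *)
Lemma flattenableP (R : realType) (X Y : normedModType R) (G : graph) :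
  flattenable X Y G <->
  forall y : vertex G -> Y, exists x : vertex G -> X,
    forall v w, adj v w -> `|x v - x w| = `|y v - y w|.
Proof.
split=> [flat y | real _ [y _ <-]].
  have [x _ xy] := flat _ (imageT (measurement G Y) y).
  exists x => v w vw.
  by rewrite -(measurementE x vw) xy measurementE.
have [x xy] := real y.
exists x => //; apply/funext => A.
exact: xy (adj_edge_ends A).
Qed.

(** A simple path from [b] to [a] in [e'] would have at least three vertices,
    so the edge [a b] would close it up to a cycle of [e]. *)
Lemma acyclic_bridge (T : finType) (e e' : rel T) (a b : T) :
  (forall c : seq T, ~ ((3 <= size c)%N /\ ucycle e c)) ->
  subrel e' e -> e a b -> a != b -> ~~ e' b a -> ~~ connect e' b a.
Proof.
move=> acyc sub eab ab e'ba; apply/negP => /connectP[p pp].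
case/shortenP: pp => q pq uq _ aq.
apply: (acyc (b :: q)); split; last first.
  by rewrite /ucycle uq andbT /= rcons_path (sub_path sub pq) -aq eab.
case: q pq aq {uq} => [|x [|y q]] //= => [_ ba|].
  by rewrite ba eqxx in ab.
by rewrite andbT => e'bx ax; rewrite ax e'bx in e'ba.
Qed.

(** Induction on the number of edges: by [acyclic_bridge] the component of one
    end of a deleted edge can be translated independently of the other end,
    which leaves all the remaining lengths unchanged. *)
Lemma acyclic_realizable (R : realType) (T : finType) (e : rel T)
    (d : T -> T -> R) :
  symmetric e -> irreflexive e ->
  (forall c : seq T, ~ ((3 <= size c)%N /\ ucycle e c)) ->
  (forall v w, d v w = d w v) -> (forall v w, 0 <= d v w) ->
  exists x : T -> R, forall v w, e v w -> `|x v - x w| = d v w.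
Proof.
move=> + + + dC d0.
have [n] := ubnP #|[set p : T * T | e p.1 p.2]%SET|.
elim: n e => // n IH e cardn eC eI acyc.
have [/existsP[[a b] /= eab]|/existsPn noedge] :=
    boolP [exists p : T * T, e p.1 p.2]; last first.
  by exists (fun=> 0) => v w evw; have := noedge (v, w); rewrite /= evw.
have ab : a != b by apply/eqP => ab; rewrite ab eI in eab.
pose e' : rel T := fun v w => [&& e v w, (v, w) != (a, b) & (v, w) != (b, a)].
have sub : subrel e' e by move=> v w /and3P[].
have e'C : symmetric e'.
  move=> v w; rewrite /e' eC; congr (_ && _).
  by rewrite andbC !xpair_eqE ![(v == _) && _]andbC.
have [x xd] : exists x : T -> R, forall v w, e' v w -> `|x v - x w| = d v w.
  apply: IH => //; last 2 first.
  - by move=> v; rewrite /e' eI.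
  - move=> c [c3 /andP[cc uc]]; apply: (acyc c); split=> //.
    by rewrite /ucycle uc (sub_cycle sub cc).
  rewrite -ltnS; apply: leq_trans cardn; rewrite ltnS.
  apply/proper_card/properP; split.
    by apply/fintype.subsetP => p; rewrite !inE => /sub.
  by exists (a, b); rewrite !inE //= /e' eqxx andbF.
have nba : ~~ connect e' b a.
  by apply: (acyclic_bridge acyc sub) => //; rewrite /e' eqxx !andbF.
(* Translate the component of [b], so that the new position of
   [b] is x a - d a b *)
pose c := x a - x b - d a b.
exists (fun v => if connect e' b v then x v + c else x v) => v w evw.
have [e'vw|] := boolP (e' v w).
  have e'sym : connect_sym e' by apply: sym_connect_sym.
  rewrite (same_connect_r e'sym (connect1 e'vw)).
  by rewrite -(xd _ _ e'vw); case: ifP => // _; congr `|_|; lra.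
rewrite /e' evw /= negb_and !negbK.
case/orP=> /eqP[-> ->]; rewrite connect0 (negbTE nba).
  by rewrite -[RHS]ger0_norm //; congr `|_|; rewrite /c; lra.
by rewrite dC distrC -[RHS]ger0_norm //; congr `|_|; rewrite /c; lra.
Qed.

(** The second corner is the projection to the unit sphere of a small
    perturbation [p + r] of the first corner [p], in a direction independent
    of [p].  This works for any norm, whereas two independent unit vectors can
    be at distance 2 from each other when the norm is not strictly convex. *)
Lemma exists_thin_triangle (R : realType) (Y : normedModType R) :
  dim_ge Y 2 ->
  exists p q : Y, [/\ `|p| = 1, `|q| = 1 & 0 < `|p - q| < 2].
Proof.
move=> [f ind].
set u := f ord0; set v := f (lift ord0 ord0).
have {}ind (a b : R) : a *: u + b *: v = 0 -> a = 0 /\ b = 0.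
  move=> ab.
  pose g (i : 'I_2) := if i == ord0 then a else b.
  have g0 : forall i, g i = 0.
    by apply: ind; rewrite big_ord_recl big_ord1 /g /=.
  by split; [exact: (g0 ord0) | exact: (g0 (lift ord0 ord0))].
have u0 : `|u| != 0.
  rewrite normr_eq0; apply/eqP => u0.
  have [|/eqP] := ind 1 0; first by rewrite u0 scaler0 scale0r addr0.
  by rewrite oner_eq0.
have v0 : `|v| != 0.
  rewrite normr_eq0; apply/eqP => v0.
  have [|_ /eqP] := ind 0 1; first by rewrite v0 scaler0 scale0r addr0.
  by rewrite oner_eq0.
pose p := `|u|^-1 *: u; pose r := (4^-1 * `|v|^-1) *: v.
have p1 : `|p| = 1 by rewrite normrZ normfV normr_id mulVf.
have r4 : `|r| = 4^-1.
  by rewrite normrZ normrM !normfV normr_id mulfVK // ger0_norm.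
pose s := `|p + r|.
have s_le : s <= 5 / 4 by have := ler_normD p r; rewrite -/s p1 r4; lra.
have s_ge : 3 / 4 <= s by have := lerB_normD p r; rewrite -/s p1 r4; lra.
have s0 : s != 0 by apply/eqP; lra.
exists p, (s^-1 *: (p + r)); split=> //.
  by rewrite normrZ normfV normr_id mulVf.
apply/andP; split.
  rewrite normr_gt0; apply/eqP => /eqP.
  rewrite subr_eq0 => /eqP pq.
  have [|_ /eqP] := ind ((s - 1) * `|u|^-1) (- (4^-1 * `|v|^-1)).
    rewrite -scalerA -/p scaleNr -/r scalerBl scale1r.
    by rewrite {1}pq scalerA divff // scale1r addrAC addrK subrr.
  by rewrite oppr_eq0 mulf_eq0 !invr_eq0 (negbTE v0) pnatr_eq0.
(* |p - q| <= |(p + r) - q| + |r| = |s - 1| + 1/4 <= 1/2 *)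
have -> : p - s^-1 *: (p + r) = (1 - s^-1) *: (p + r) - r.
  by rewrite scalerBl scale1r addrAC addrK.
apply: le_lt_trans (ler_normB _ _) _.
rewrite normrZ r4 -/s -{2}[s]ger0_norm ?normr_ge0 // -normrM mulrBl mul1r.
rewrite mulVf //.
have : `|s - 1| <= 4^-1 by rewrite ler_norml; apply/andP; split; lra.
lra.
Qed.

Lemma line_no_thin_triangle (R : realType) (a b c : R) :
  `|a - b| = 1 -> `|a - c| = 1 -> ~~ (0 < `|b - c| < 2).
Proof.
move=> ab ac; apply/negP.
move: ab ac; case: (ler0P (a - b)); case: (ler0P (a - c));
  case: (ler0P (b - c)) => *; lra.
Qed.

Lemma path_const (T : eqType) (S : Type) (e : rel T) (A : pred T) (x : T -> S)
    (v : T) (p : seq T) :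
  (forall a b, A a -> A b -> e a b -> x a = x b) ->
  path e v p -> all A (v :: p) -> x (last v p) = x v.
Proof.
move=> xE; elim: p v => //= w p IH v /andP[evw pp] /and3P[Av Aw Ap].
by rewrite IH ?Aw // (xE v w).
Qed.

Theorem proposition3p4 (R : realType) (X Y : normedModType R)
    (hX : dim_eq X 1) :
  (dim_eq Y 1 -> forall G : graph, flattenable X Y G) /\
  (dim_ge Y 2 -> forall G : graph, flattenable X Y G <-> forest G).
Proof.
have [e e1 eX] := dim_eq1_unit hX.
split=> [/dim_eq1_unit[u u1 uY] G | dimY G].
  apply/flattenableP => y.
  have [b yb] := choice (fun v => uY (y v)).
  exists (fun v => b v *: e) => v w _.
  by rewrite !yb !dist_scale_unit.
split=> [/flattenableP flat [c [c3 /andP[cc uc]]] | forestG]; last first.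
  apply/flattenableP => y.
  have [x xy] : exists x : vertex G -> R,
      forall v w, adj v w -> `|x v - x w| = `|y v - y w|.
    apply: (@acyclic_realizable _ _ _ (fun v w => `|y v - y w|)).
    - exact: adj_sym.
    - exact: adj_irr.
    - by move=> c cyc; apply: forestG; exists c.
    - by move=> v w; rewrite distrC.
    - by move=> v w; exact: normr_ge0.
  by exists (fun v => x v *: e) => v w vw; rewrite dist_scale_unit // xy.
have [p [q [p1 q1 pq]]] := exists_thin_triangle dimY.
case: c c3 cc uc => [|v0 [|v1 [|v2 c]]] // _.
rewrite /= rcons_path => /and4P[v01 v12 cpath clast].
rewrite !inE !negb_or.
move=> /andP[/and3P[n01 n02 n0c] /andP[/andP[n12 n1c] _]].
(* The cycle v0, v1, v2, ... is sent to the triangle 0, p, q, q, ... *)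
pose y v := if v == v0 then 0 else if v == v1 then p else q.
have [x xy] := flat y.
have [a xa] := choice (fun v => eX (x v)).
have {xy}ay v w : adj v w -> `|a v - a w| = `|y v - y w|.
  by move=> vw; rewrite -(dist_scale_unit _ _ e1) -!xa xy.
pose away v := (v != v0) && (v != v1).
have yq v : away v -> y v = q.
  by case/andP => /negbTE nv0 /negbTE nv1; rewrite /y nv0 nv1.
have awayc : all away (v2 :: c).
  apply/allP => v vc; apply/andP; split; apply: contraTneq vc => ->.
    by rewrite inE negb_or n02.
  by rewrite inE negb_or n12.
have y0 : y v0 = 0 by rewrite /y eqxx.
have y1 : y v1 = p by rewrite /y eq_sym (negbTE n01) eqxx.
have y2 : y v2 = q by apply: yq; case/andP: awayc.
have ylast : y (last v2 c) = q.
  by apply: yq; apply: (allP awayc); exact: mem_last.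
have alast : a (last v2 c) = a v2.
  apply: path_const cpath awayc => v w Av Aw /ay.
  by rewrite !yq // subrr normr0 => /eqP; rewrite normr_eq0 subr_eq0 => /eqP.
have := @line_no_thin_triangle _ (a v0) (a v1) (a v2).
rewrite (ay _ _ v01) (ay _ _ v12) -alast [`|a v0 - _|]distrC (ay _ _ clast).
rewrite y0 y1 y2 ylast sub0r normrN subr0 pq.
by move=> /(_ p1 q1).
Qed.
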